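(* Let $\beta>1$ satisfy $\beta^3=\beta+1$. For positive integers $M$, as $M\to\infty$, $$\frac1{2M+1}\sum_{N=-M}^M\|N\|_S=\frac1{7+2\beta^2}\,\frac{\log M}{\log\beta}+\mathcal O(1).$$
   Context: The sequence $(S_n)_{n\ge0}$: $S_0=1$, $S_1=2$, $S_2=3$, $S_3=4$, $S_n=S_{n-2}+S_{n-3}$ for $n\ge4$. A word $x=x_1\cdots x_n$ over $\mathbb Z$ represents $\sum_{j=1}^n x_jS_{n-j}$; $\|x\|=\sum_j|x_j|$. For $N\in\mathbb Z$, $\|N\|_S$ is the weight of an $S$-expansion of minimal weight of $N$, i.e. the minimum of $\|x\|$ over all words $x\in\mathbb Z^*$ representing $N$. *)

(* Defs.v *)
From HB Require Import structures.
From mathcomp Require Import all_boot all_order all_algebra.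
From mathcomp Require Import all_classical all_reals all_analysis.

Set Implicit Arguments.
Unset Strict Implicit.
Unset Printing Implicit Defensive.

Import Order.TTheory GRing.Theory Num.Theory.

Local Open Scope ring_scope.

(* In the last branch the argument is n = n'.+4, with n2 = n - 2 and
   n3 = n - 3. *)
Fixpoint Sseq (n : nat) : nat :=
  match n with
  | 0 => 1
  | 1 => 2
  | 2 => 3
  | 3 => 4
  | (((n'.+1) as n3).+1 as n2).+2 => (Sseq n2 + Sseq n3)%N
  end.

(* The letter x_j of x_1 ... x_n is the entry of index j - 1 of the sequence,
   so the index i carries the coefficient S_(n - (i + 1)). *)
Definition word_value (x : seq int) : int :=
  \sum_(i < size x) x`_i * (Sseq (size x - i.+1))%:Z.

Definition word_weight (x : seq int) : nat := (\sum_(a <- x) `|a|)%N.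

Definition has_expansion_of_weight (N : int) (k : nat) : Prop :=
  exists x : seq int, word_value x = N /\ word_weight x = k.

(* The one-letter word N represents N, because S_0 = 1. *)
Lemma ex_expansion (N : int) : exists k, `[< has_expansion_of_weight N k >].
Proof.
exists `|N|%N; apply/asboolP; exists [:: N]; split.
  by rewrite /word_value big_ord_recl big_ord0 /= addr0 mulr1.
by rewrite /word_weight big_seq1.
Qed.

Definition Snorm (N : int) : nat := ex_minn (ex_expansion N).

(* Main.v *)
Require Import Defs.
From HB Require Import structures.
From Stdlib Require Import ZArith FMapPositive.
From mathcomp Require Import all_boot all_order all_algebra.
From mathcomp Require Import all_classical all_reals all_analysis.
From mathcomp Require Import ssrZ zify ring lra.

Set Implicit Arguments.
Unset Strict Implicit.
Unset Printing Implicit Defensive.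

Import Order.TTheory GRing.Theory Num.Theory.
Import numFieldNormedType.Exports.

(* Let t_n = thr (n + 8). Since t_n + t_(n-6) + 1 = S_(n+1) and
   t_n = S_n + t_(n-8), the intervals t_(n-1) < N <= t_n tile the positive
   integers, and subtracting S_n maps the n-th one onto [- t_(n-7), t_(n-8)].
   Iterating this greedy step expands N with digits -1, 0, 1, where nonzero
   digits are at distance at least 8 (equal signs) or 7 (opposite signs), up to
   irregularities in the last positions.

   These expansions have minimal weight: the greedy weight vanishes at 0 and
   grows by at most 1 when some S_n is added. For the latter, the greedy
   expansions of N and N + S_n are read in parallel from the left; the pending
   difference, an integer combination of three consecutive terms of S, takes
   finitely many values, and a shortest-path computation on the resulting
   finite graph bounds the difference of the weights.

   For the mean value, the greedy step turns the cumulative weights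
   G(t_n) = ||1|| + ... + ||t_n|| into the recurrence
   G(t_n) = G(t_(n-1)) + G(t_(n-7)) + G(t_(n-8)) + t_n - t_(n-1).
   With t_n growing like beta ^ n this gives G(t_n) = c n t_n + O(t_n), where c
   is the inverse of the mean distance 7 + 2 beta ^ 2 between nonzero digits,
   and one more greedy step extends the estimate to G(M) for every M. *)

(** * Threshold sequence *)

Local Open Scope classical_set_scope.
Local Open Scope nat_scope.

(* The index is shifted by 8 so that t_(-8), ..., t_(-1) make sense: both
   identities of the header then hold for all n >= 0. *)
Fixpoint thr (n : nat) : nat :=
  match n with
  | 6 | 7 => 1
  | n'.+4.+4 => Sseq n' + thr n'
  | _ => 0
  end.

Lemma SseqE n : Sseq n.+4 = Sseq n.+2 + Sseq n.+1.
Proof. by []. Qed.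

Lemma thrE n : thr (n + 8) = Sseq n + thr n.
Proof. by rewrite addnC. Qed.

Lemma nat_ind8 (P : nat -> Prop) :
  P 0 -> P 1 -> P 2 -> P 3 -> P 4 -> P 5 -> P 6 -> P 7 ->
  (forall n, P n -> P (n + 8)) -> forall n, P n.
Proof.
move=> P0 P1 P2 P3 P4 P5 P6 P7 PS n; have [m] := ubnP n; elim: m n => // m IH n.
case: (ltnP n 8) => [|le8 nm]; first by case: n => [|[|[|[|[|[|[|[|]]]]]]]].
rewrite -(subnK le8); apply: PS; apply: IH; lia.
Qed.

(** In steps of 8 this reduces to S_(n+9) = S_(n+8) + S_(n+2) + S_(n+1), which follows from the
    recurrence of S. *)
Lemma Sseq_thr n : Sseq n.+1 = thr (n + 8) + thr (n + 2) + 1.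
Proof.
elim/nat_ind8: n => // n; rewrite (thrE (n + 8)) (addnAC n 8 2) (thrE (n + 2)).
rewrite !(addnS, addn0) !SseqE => H; lia.
Qed.

Lemma Sseq_gt0 n : 0 < Sseq n.
Proof. case: n => // n; rewrite Sseq_thr; lia. Qed.

Lemma Sseq_mono : {homo Sseq : m n / m <= n}.
Proof.
apply: homo_leq => [//|//|n]; first by move=> ? ? ?; apply: leq_trans.
have [m] := ubnP n; elim: m n => // m IH [|[|[|[|n]]]] // nm.
rewrite !(SseqE n.+1) SseqE; apply: leq_add; apply: IH; lia.
Qed.

Lemma thr_mono : {homo thr : m n / m <= n}.
Proof.
apply: homo_leq => [//|//|n]; first by move=> ? ? ?; apply: leq_trans.
elim/nat_ind8: n => // n IH; rewrite -addSn !thrE.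
by apply: leq_add => //; apply: Sseq_mono.
Qed.

(** * Greedy expansions and the finite graph comparing two of them *)

Section Greedy.
Local Open Scope Z_scope.

Definition SZ n : Z := Z.of_nat (Sseq n).
Definition tZ n : Z := Z.of_nat (thr n).

Lemma tZ_mono m n : (m <= n)%N -> tZ m <= tZ n.
Proof. by move=> /thr_mono; rewrite /tZ; lia. Qed.

(* Meaningful for |N| <= t_m only. *)
Fixpoint gweight (m : nat) (N : Z) : nat :=
  if m is m'.+1 then
    if tZ (m' + 8) <? N then (gweight m' (N - SZ m)).+1
    else if N <? - tZ (m' + 8) then (gweight m' (N + SZ m)).+1
    else gweight m' N
  else Z.abs_nat N.

(* What remains at positions m, ..., 0 lies in [- t_(m-p.1), t_(m-p.2)]: p is
   (0, 0) if the next digit is free, (6, 7) just after a digit 1 and (7, 6)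
   just after a digit -1. *)
Definition within (p : nat * nat) (m : nat) (N : Z) : bool :=
  (- tZ (m + 8 - p.1) <=? N) && (N <=? tZ (m + 8 - p.2)).

(** [p.1] and [p.2] count the positions at which -1 and 1 remain forbidden; starting from 6 or 7
    they enforce the distances 7 and 8. *)
Definition digits (p : nat * nat) : seq (Z * (nat * nat)) :=
  (0, (p.1.-1, p.2.-1)) ::
  (if p.2 is O then [:: (1, (6, 7)%N)] else [::]) ++
  (if p.1 is O then [:: (-1, (7, 6)%N)] else [::]).

(** A positive counter bounds N by t_m on its side, so the greedy step never takes a forbidden
    digit. After a digit 1 the two identities for t place the remainder in [- t_(m-6), t_(m-7)]; -1
    is symmetric. *)
Lemma digitsP p m N : within p m.+1 N ->
  exists2 x : Z * (nat * nat), x \in digits p &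
    within x.2 m (N - x.1 * SZ m.+1) /\
    Z.of_nat (gweight m.+1 N) = Z.abs x.1 + Z.of_nat (gweight m (N - x.1 * SZ m.+1)).
Proof.
case: p => i j; rewrite /within /= => /andP[/Z.leb_le le_iN /Z.leb_le le_Nj].
have ES := Sseq_thr m; have Et := thrE m.+1.
have E6 : (m + 8 - 6)%N = (m + 2)%N by lia.
have E7 : (m + 8 - 7)%N = m.+1 by lia.
case: Z.ltb_spec => [ltN|leN].
  case: j le_Nj => [|j] le_Nj; last first.
    have /tZ_mono : (m.+1 + 8 - j.+1 <= m + 8)%N by lia.
    by move=> ?; exfalso; lia.
  exists (1, (6, 7)%N); first by rewrite in_cons mem_head orbT.
  have -> : N - 1 * SZ m.+1 = N - SZ m.+1 by lia.
  split; cbn [fst snd]; last by lia.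
  rewrite E6 E7; apply/andP; split; apply/Z.leb_le;
    by move: ltN le_Nj ES Et; rewrite subn0 /tZ /SZ; lia.
case: Z.ltb_spec => [ltN|leN'].
  case: i le_iN => [|i] le_iN; last first.
    have /tZ_mono : (m.+1 + 8 - i.+1 <= m + 8)%N by lia.
    by move=> ?; exfalso; lia.
  exists (-1, (7, 6)%N); first by rewrite in_cons mem_cat mem_head !orbT.
  have -> : N - -1 * SZ m.+1 = N + SZ m.+1 by lia.
  split; cbn [fst snd]; last by lia.
  rewrite E6 E7; apply/andP; split; apply/Z.leb_le;
    by move: ltN le_iN ES Et; rewrite subn0 /tZ /SZ; lia.
exists (0, (i.-1, j.-1)); first exact: mem_head.
have -> : N - 0 * SZ m.+1 = N by lia.
split=> //=.
apply/andP; split; apply/Z.leb_le.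
  case: i le_iN => [|i] le_iN; first by rewrite subn0.
  by rewrite /= (_ : (m + 8 - i = m.+1 + 8 - i.+1)%N) //; lia.
case: j le_Nj => [|j] le_Nj; first by rewrite subn0.
by rewrite /= (_ : (m + 8 - j = m.+1 + 8 - j.+1)%N) //; lia.
Qed.

(* Pair of partially read expansions of N and N'. Here N' - N is da S_(m+2) +
   db S_(m+1) + dc S_m, plus a term S_n still to come when pending. *)
Record state := State {
  src : nat * nat; tgt : nat * nat; da : Z; db : Z; dc : Z; pending : bool }.

Definition lin (a b c : Z) (m : nat) : Z :=
  a * SZ m.+2 + b * SZ m.+1 + c * SZ m.

Definition differ (s : state) (m : nat) (D : Z) : Prop :=
  if pending s then exists2 n, (n <= m)%N & D = lin (da s) (db s) (dc s) m + SZ n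
  else D = lin (da s) (db s) (dc s) m.

Definition gap_le (s : state) (h : Z) (m : nat) : Prop :=
  forall N N', within (src s) m N -> within (tgt s) m N' ->
  differ s m (N' - N) -> Z.of_nat (gweight m N') <= Z.of_nat (gweight m N) + h.

(** [e] says that the pending S_n sits at the position being read; it then enters the coefficients
    together with the digit difference. *)
Definition succ_state (s : state) (x y : Z * (nat * nat)) (e : bool) : state :=
  State x.2 y.2 (db s) (dc s + da s + Z.b2z e - (y.1 - x.1)) (da s)
    (pending s && ~~ e).

(** The edge length |x| - |y| is the change in the budget by which the weight of N' may still exceed
    that of N. *)
Definition succs (s : state) : seq (Z * state) :=
  flatten [seq flatten [seq [seq (Z.abs x.1 - Z.abs y.1, succ_state s x y e)
                             | e <- if pending s then [:: false; true] else [:: false]]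
                       | y <- digits (tgt s)]
          | x <- digits (src s)].

(* lin satisfies the recurrence of S, so three consecutive values decide. *)
Definition lin_nonneg (a b c : Z) : bool :=
  [&& 0 <=? lin a b c 1, 0 <=? lin a b c 2 & 0 <=? lin a b c 3].

(* |N|, |N'| < S_(m+1) excludes larger differences. *)
Definition pruned (s : state) : bool :=
  lin_nonneg (da s) (db s - 2) (dc s) ||
  lin_nonneg (- da s) (- db s - 2) (- dc s - Z.b2z (pending s)).

(* Injectivity is not needed: the table stores the states themselves. *)
Definition key (s : state) : positive :=
  let f x k := x + 16 * k in
  Z.to_pos (1 + f (Z.of_nat (src s).1) (f (Z.of_nat (src s).2)
    (f (Z.of_nat (tgt s).1) (f (Z.of_nat (tgt s).2)
    (f (da s + 8) (f (db s + 8) (f (dc s + 8) (Z.b2z (pending s))))))))).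

Definition state_eqb (s s' : state) : bool :=
  [&& src s == src s', tgt s == tgt s', Z.eqb (da s) (da s'),
      Z.eqb (db s) (db s'), Z.eqb (dc s) (dc s') & pending s == pending s'].

Definition table := PositiveMap.t (state * Z).

Definition relax (q : table * seq state) (s : state) (h : Z) :=
  if pruned s then q else
  let upd := (PositiveMap.add (key s) (s, h) q.1, s :: q.2) in
  if PositiveMap.find (key s) q.1 is Some sh then
    if h <? sh.2 then upd else q
  else upd.

Definition explore (tb : table) (f : seq state) : table * seq state :=
  foldl (fun q s =>
    if PositiveMap.find (key s) tb is Some sh then
      foldl (fun q x => relax q x.2 (sh.2 + x.1)) q (succs s)
    else q) (tb, [::]) f.

Fixpoint saturate (k : nat) (tb : table) (f : seq state) : table :=
  if k is k'.+1 then
    if f is [::] then tb else let q := explore tb f in saturate k' q.1 q.2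
  else tb.

Definition start : state := State (0, 0)%N (0, 0)%N 0 0 0 true.

(** Shortest paths by repeated relaxation from [start] with budget 1: each state is stored with the
    least budget found for the digits still unread. The result is certified afterwards by
    [table_ok]. *)
Definition gap_table : table :=
  saturate 100 (PositiveMap.add (key start) (start, 1) (PositiveMap.empty _)) [:: start].

(** At m = 1 remainders have absolute value at most S_2 - 1 = 2, and a pending term is S_0 = 1 or
    S_1 = 2. *)
Definition base_ok (s : state) (h : Z) : bool :=
  all (fun N => all (fun k =>
      let N' := N + lin (da s) (db s) (dc s) 1 + k in
      within (src s) 1 N && within (tgt s) 1 N' ==>
        (Z.of_nat (gweight 1 N') <=? Z.of_nat (gweight 1 N) + h))
    (if pending s then [:: 1; 2] else [:: 0])) [:: -2; -1; 0; 1; 2].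

(** Local consistency along edges, which makes the table an invariant for the induction on m. *)
Definition step_ok (tb : table) (s : state) (h : Z) : bool :=
  List.forallb (fun x : Z * state => pruned x.2 ||
    (if PositiveMap.find (key x.2) tb is Some sh then
       state_eqb sh.1 x.2 && (sh.2 <=? h + x.1) else false)) (succs s).

Definition table_ok (tb : table) : bool :=
  List.forallb (fun kx => base_ok kx.2.1 kx.2.2 && step_ok tb kx.2.1 kx.2.2)
    (PositiveMap.elements tb).

Lemma gap_table_ok : table_ok gap_table.
Proof. by vm_compute. Qed.

(** * Soundness of the computation and the Lipschitz bound *)

Lemma lin_step a b c m : lin a b c m.+2 = lin b (c + a) a m.+1.
Proof.
have : SZ m.+4 = SZ m.+2 + SZ m.+1 by rewrite /SZ SseqE; lia.
by rewrite /lin => ->; ring.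
Qed.

Lemma lin_ge0 a b c m : lin_nonneg a b c -> 0 <= lin a b c m.+1.
Proof.
case/and3P=> /Z.leb_le ge1 /Z.leb_le ge2 /Z.leb_le ge3.
suff [//] : [/\ 0 <= lin a b c m.+1, 0 <= lin a b c m.+2
             & 0 <= lin a b c m.+3].
elim: m => [//|m [IH1 IH2 IH3]]; split=> //.
have E k : SZ k.+4 = SZ k.+2 + SZ k.+1 by rewrite /SZ SseqE; lia.
move: IH1 IH2; rewrite /lin (E m.+2) (E m.+1) (E m); nia.
Qed.

Lemma within_abs p m N : within p m N -> Z.abs N <= SZ m.+1 - 1.
Proof.
case/andP=> /Z.leb_le l1 /Z.leb_le l2.
have /tZ_mono t1 : (m + 8 - p.1 <= m + 8)%N by lia.
have /tZ_mono t2 : (m + 8 - p.2 <= m + 8)%N by lia.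
by have := Sseq_thr m; move: l1 l2 t1 t2; rewrite /tZ /SZ; lia.
Qed.

(** A pending term lies between 1 and S_(m+1). It only helps when [lin] is too large, and the
    correction of [dc] in [pruned] pays for it when [lin] is too small. *)
Lemma prunedP s m N N' : pruned s -> within (src s) m.+1 N ->
  within (tgt s) m.+1 N' -> ~ differ s m.+1 (N' - N).
Proof.
move=> prs /within_abs leN /within_abs leN'.
have : 0 <= lin (da s) (db s - 2) (dc s) m.+1 \/
       0 <= lin (- da s) (- db s - 2) (- dc s - Z.b2z (pending s)) m.+1.
  by case/orP: prs => /(@lin_ge0 _ _ _ m); [left|right].
rewrite /differ /lin; case: (pending s) => /= h; last by case: h => h E; nia.
case=> n; rewrite leq_eqVlt ltnS => /orP n_le.
have : 0 < SZ n <= SZ m.+1.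
  have /Sseq_mono : (n <= m.+1)%N by case: n_le => [/eqP ->|/leqW].
  by move: (Sseq_gt0 n); rewrite /SZ; lia.
case: h => h S_n E; nia.
Qed.

Lemma succ_state_succs s x y e : x \in digits (src s) -> y \in digits (tgt s) ->
  (e ==> pending s) ->
  List.In (Z.abs x.1 - Z.abs y.1, succ_state s x y e) (succs s).
Proof.
have In_flatten (T : eqType) (U : Type) (f : T -> seq U) r z u :
    z \in r -> List.In u (f z) -> List.In u (flatten (map f r)).
  elim: r => //= z' r IH; rewrite inE => /orP[/eqP-> | zr] uf;
    apply: List.in_or_app; [by left | by right; apply: IH].
move=> xs ys es; apply: (In_flatten _ _ _ _ _ _ xs); apply: (In_flatten _ _ _ _ _ _ ys).
by case: (pending s) es; case: e => //= _; [right; left|left|left].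
Qed.

Lemma table_okP tb s h : table_ok tb ->
  PositiveMap.find (key s) tb = Some (s, h) -> base_ok s h /\ step_ok tb s h.
Proof.
move=> ok find_s; apply/andP; have in_tb := PositiveMap.elements_correct _ _ find_s.
exact: (proj1 (List.forallb_forall _ _) ok _ in_tb).
Qed.

Lemma base_gap_le s h : base_ok s h -> gap_le s h 1.
Proof.
move=> /allP okh N N' wN wN' dNN'.
have : Z.abs N <= 2 by exact: (within_abs wN).
move=> N2; have /okh/allP {}okh : N \in [:: -2; -1; 0; 1; 2].
  by rewrite !inE; move: N2; rewrite !eqE /=; lia.
have [k kP EN'] : exists2 k, k \in (if pending s then [:: 1; 2] else [:: 0])
    & N' = N + lin (da s) (db s) (dc s) 1 + k.
  move: dNN'; rewrite /differ; case: (pending s) => [[[|[|n]] // _ E]|E].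
  - by exists 1; [exact: mem_head | move: E; rewrite /SZ /=; lia].
  - by exists 2; [rewrite !inE eqxx orbT | move: E; rewrite /SZ /=; lia].
  - by exists 0; [exact: mem_head | lia].
move: (okh k kP) => /=; rewrite -EN' wN wN' => /implyP/(_ isT)/Z.leb_le.
exact.
Qed.

Lemma state_eqbP s s' : state_eqb s s' -> s = s'.
Proof.
case: s s' => [p q a b c e] [p' q' a' b' c' e'] /and5P[] /=.
by move=> /eqP-> /eqP-> /Z.eqb_eq-> /Z.eqb_eq-> /andP[/Z.eqb_eq-> /eqP->].
Qed.

(** One digit of each expansion is read; the new pair of remainders is either impossible by pruning
    or covered by a table entry whose budget fits the edge. *)
Lemma gap_table_sound m s h :
  PositiveMap.find (key s) gap_table = Some (s, h) -> gap_le s h m.+1.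
Proof.
elim: m s h => [|m IH] s h /(table_okP gap_table_ok)[base_s step_s].
  exact: base_gap_le.
move=> N N' wN wN' dNN'.
have [x xs [wx Ex]] := digitsP wN; have [y ys [wy Ey]] := digitsP wN'.
(* [e] is true when the pending S_n has n = m.+2, the position being read. *)
have [e es dnext] : exists2 e : bool, e ==> pending s &
    differ (succ_state s x y e) m.+1 (N' - y.1 * SZ m.+2 - (N - x.1 * SZ m.+2)).
  move: dNN'; rewrite /differ /= lin_step.
  set X := lin (db s) _ _ _; have EX e : lin (db s)
    (dc s + da s + Z.b2z e - (y.1 - x.1)) (da s) m.+1 =
      X + Z.b2z e * SZ m.+2 - (y.1 - x.1) * SZ m.+2 by rewrite /X /lin; ring.
  case: (pending s) => [[n n_le EN]|EN]; last by exists false; rewrite ?EX /=; lia.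
  move: n_le; rewrite leq_eqVlt ltnS => /predU1P[En | n_le].
    by exists true => //=; rewrite (EX true) Z.mul_1_l -En; lia.
  by exists false => //=; exists n => //; rewrite (EX false) /=; lia.
have le_wgt h' : gap_le (succ_state s x y e) h' m.+1 ->
    h' <= h + (Z.abs x.1 - Z.abs y.1) ->
    Z.of_nat (gweight m.+2 N') <= Z.of_nat (gweight m.+2 N) + h.
  by move=> /(_ _ _ wx wy dnext); lia.
have /List.forallb_forall/(_ _ (succ_state_succs xs ys es)) := step_s.
case/orP => [prn | /=]; first by case: (prunedP prn wx wy dnext).
case E: PositiveMap.find => [[s' h']|//] /andP[/= /state_eqbP Es /Z.leb_le].
by rewrite Es in E; apply: le_wgt; apply: IH.
Qed.

Lemma gweight_lip m n N : (n <= m)%N -> within (0, 0)%N m.+1 N ->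
  within (0, 0)%N m.+1 (N + SZ n) -> (gweight m.+1 (N + SZ n) <= (gweight m.+1 N).+1)%N.
Proof.
move=> le_nm wN wN'.
(* No cycle through [start] has lowered its initial budget 1. *)
have find_start : PositiveMap.find (key start) gap_table = Some (start, 1).
  by vm_compute.
suff /(gap_table_sound find_start wN wN') : differ start m.+1 (N + SZ n - N) by lia.
by exists n; [apply: leqW | rewrite /lin /=; lia].
Qed.

(** The length |N| suffices because n <= t_n; by [gweightE] every sufficient length gives the same
    value. *)
Definition weight (N : Z) : nat := gweight (Z.abs_nat N) N.

Lemma leq_thr n : (n <= thr (n + 8))%N.
Proof.
by elim: n => // n IH; have := Sseq_thr n; have := Sseq_gt0 n; rewrite (thrE n.+1); lia.
Qed.

Lemma gweightS m N : Z.abs N <= tZ (m + 8) -> gweight m.+1 N = gweight m N.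
Proof. by move=> /= leN; case: Z.ltb_spec; [lia | case: Z.ltb_spec => //; lia]. Qed.

Lemma gweightE m N : Z.abs N <= tZ (m + 8) -> gweight m N = weight N.
Proof.
have gweightD d k : Z.abs N <= tZ (k + 8) -> gweight (d + k) N = gweight k N.
  elim: d => // d IH leN; rewrite addSn gweightS ?IH //.
  by apply: Z.le_trans leN _; apply: tZ_mono; lia.
move=> leN; rewrite /weight; have leN' : Z.abs N <= tZ (Z.abs_nat N + 8).
  by have := leq_thr (Z.abs_nat N); rewrite /tZ; lia.
case/orP: (leq_total m (Z.abs_nat N)) => le.
  by rewrite -(subnK le) gweightD.
by rewrite -(subnK le) gweightD.
Qed.

Lemma withinE m N : within (0, 0)%N m N <-> Z.abs N <= tZ (m + 8).
Proof. by rewrite /within !subn0; split; [move=> /andP[]|]; lia. Qed.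

Lemma weight_lip n N : (weight (N + SZ n) <= (weight N).+1)%N.
Proof.
pose m := (n + Z.abs_nat N + Z.abs_nat (N + SZ n))%N.
have := leq_thr m.+1; move E: (thr _) => t le_t.
have wN : Z.abs N <= tZ (m.+1 + 8) by rewrite /tZ E /m in le_t *; lia.
have wN' : Z.abs (N + SZ n) <= tZ (m.+1 + 8) by rewrite /tZ E /m in le_t *; lia.
rewrite -(gweightE wN) -(gweightE wN'); apply: gweight_lip; try exact/withinE.
rewrite /m; lia.
Qed.

Lemma gweightN m N : gweight m (- N) = gweight m N.
Proof.
elim: m N => [|m IH] N /=; first by lia.
have t_ge0 : 0 <= tZ (m + 8) by rewrite /tZ; lia.
case: Z.ltb_spec => h1; (case: Z.ltb_spec => h2);
  try (case: Z.ltb_spec => h3); try (case: Z.ltb_spec => h4) => //; try lia.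
- by rewrite -IH; congr (gweight _ _).+1; lia.
- by rewrite -IH; congr (gweight _ _).+1; lia.
Qed.

Lemma weightN N : weight (- N) = weight N.
Proof. by rewrite /weight gweightN; congr gweight; lia. Qed.

Lemma weight_mul_lip n N a : (weight (N + a * SZ n) <= weight N + Z.abs_nat a)%N.
Proof.
have up N' k : (weight (N' + Z.of_nat k * SZ n) <= weight N' + k)%N.
  elim: k => [|k IH]; first by rewrite Z.add_0_r addn0.
  have -> : N' + Z.of_nat k.+1 * SZ n = N' + Z.of_nat k * SZ n + SZ n by lia.
  by have := weight_lip n (N' + Z.of_nat k * SZ n); lia.
case: (Z.le_ge_cases 0 a) => ge.
  by have := up N (Z.abs_nat a); rewrite (_ : Z.of_nat _ = a) //; lia.
have := up (- N) (Z.abs_nat a); rewrite weightN -(weightN (N + _)).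
have -> : Z.of_nat (Z.abs_nat a) = - a by lia.
by have -> : - N + - a * SZ n = - (N + a * SZ n) by lia.
Qed.

End Greedy.

(** * Minimality of the greedy weight *)

Section Expansions.
Local Open Scope ring_scope.

Lemma word_value_cons (a : int) (x : seq int) :
  word_value (a :: x) = a * (Sseq (size x))%:Z + word_value x.
Proof. by rewrite /word_value big_ord_recl /= subSS subn0. Qed.

Lemma word_weight_cons (a : int) (x : seq int) :
  word_weight (a :: x) = (`|a| + word_weight x)%N.
Proof. by rewrite /word_weight big_cons. Qed.

(** Built up from 0, the value changes by a S_n for each letter a, which raises the greedy weight by
    at most |a|. *)
Lemma weight_word_value (x : seq int) :
  (weight (Z_of_int (word_value x)) <= word_weight x)%N.
Proof.
elim: x => [|a x IH]; first by rewrite /word_value big_ord0.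
rewrite word_value_cons word_weight_cons.
have -> : Z_of_int (a * (Sseq (size x))%:Z + word_value x) =
  (Z_of_int (word_value x) + Z_of_int a * SZ (size x))%Z by rewrite /SZ; lia.
apply: leq_trans (weight_mul_lip _ _ _) _.
by rewrite addnC leq_add // (_ : Z.abs_nat _ = `|a|%N) //; lia.
Qed.

Lemma gweight_expansion (m : nat) (N : Z) : (Z.abs N <= tZ (m + 8))%Z ->
  exists x : seq int,
    [/\ size x = m.+1, Z_of_int (word_value x) = N & word_weight x = gweight m N].
Proof.
elim: m N => [|m IH] N leN.
  (* As S_0 = 1, the final remainder serves as the last letter. *)
  exists [:: int_of_Z N]; rewrite word_value_cons word_weight_cons.
  rewrite /word_value big_ord0 /word_weight big_nil; split=> //=; lia.
have Es := Sseq_thr m; have Et := thrE m.+1.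
have t1 : (thr (m + 2) <= thr (m + 8))%N by apply: thr_mono; lia.
have t2 : (thr m.+1 <= thr (m + 8))%N by apply: thr_mono; lia.
rewrite /=; case: Z.ltb_spec => [ltN|geN].
  have [|x [sz_x val_x wgt_x]] := IH (N - SZ m.+1)%Z.
    by move: ltN leN; rewrite /tZ /SZ; lia.
  exists (1 :: x); rewrite word_value_cons word_weight_cons wgt_x /= sz_x.
  by split=> //; move: val_x; rewrite /SZ; lia.
case: Z.ltb_spec => [ltN|leN'].
  have [|x [sz_x val_x wgt_x]] := IH (N + SZ m.+1)%Z.
    by move: ltN leN; rewrite /tZ /SZ; lia.
  exists (-1 :: x); rewrite word_value_cons word_weight_cons wgt_x /= sz_x.
  by split=> //; move: val_x; rewrite /SZ; lia.
have [|x [sz_x val_x wgt_x]] := IH N; first by lia.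
exists (0 :: x); rewrite word_value_cons word_weight_cons wgt_x /= sz_x.
by split=> //; lia.
Qed.

Lemma SnormE (N : int) : Snorm N = weight (Z_of_int N).
Proof.
rewrite /Snorm; case: ex_minnP => k /asboolP[x [val_x wgt_x]] k_min.
apply/eqP; rewrite eqn_leq -{2}wgt_x -val_x weight_word_value andbT.
apply: k_min; apply/asboolP; pose m := Z.abs_nat (Z_of_int N).
have [|y [_ val_y wgt_y]] := @gweight_expansion m (Z_of_int N).
  by have := leq_thr m; rewrite /tZ /m; lia.
by exists y; rewrite val_x; split=> //; lia.
Qed.

Lemma SnormN (N : int) : Snorm (- N) = Snorm N.
Proof. by rewrite !SnormE -weightN; congr weight; lia. Qed.

Lemma Snorm0 : Snorm 0 = 0%N.
Proof. by rewrite SnormE. Qed.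

Lemma Snorm_leading (n N : nat) : (0 < n)%N -> (thr (n + 7) < N <= thr (n + 8))%N ->
  Snorm N%:Z = (Snorm (N%:Z - (Sseq n)%:Z)).+1.
Proof.
case: n => // m _ /andP[ltN leN].
rewrite !SnormE -(@gweightE m.+1) ?/tZ; last by lia.
have Es := Sseq_thr m; have Et := thrE m.+1.
have t1 : (thr (m + 2) <= thr (m + 8))%N by apply: thr_mono; lia.
have t2 : (thr m.+1 <= thr (m + 8))%N by apply: thr_mono; lia.
rewrite -(@gweightE m (Z_of_int (N%:Z - _))) /tZ; last by rewrite addSnnS in ltN; lia.
cbn [gweight]; case: Z.ltb_spec => [_|]; last by rewrite addSnnS in ltN; rewrite /tZ; lia.
by congr (gweight _ _).+1; rewrite /SZ; lia.
Qed.

End Expansions.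

(** * Recurrence for cumulative weights *)

Section CumulativeWeight.
Local Open Scope nat_scope.

Definition cumSnorm (M : nat) : nat := \sum_(1 <= N < M.+1) Snorm N%:Z.

Lemma cumSnorm0 : cumSnorm 0 = 0.
Proof. by rewrite /cumSnorm big_geq. Qed.

Lemma cumSnormS M : cumSnorm M.+1 = cumSnorm M + Snorm M.+1%:Z.
Proof. by rewrite /cumSnorm big_nat_recr. Qed.

(** The norm is even and vanishes at 0. *)
Lemma sum_Snorm_sym M :
  \sum_(0 <= i < (2 * M).+1) Snorm (i%:Z - M%:Z)%R = 2 * cumSnorm M.
Proof.
elim: M => [|M IH]; first by rewrite !muln0 cumSnorm0 big_nat1 subrr Snorm0.
have -> : 2 * M.+1 = (2 * M).+2 by lia.
rewrite big_nat_recl // big_nat_recr //= cumSnormS.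
rewrite (eq_bigr (fun i => Snorm (i%:Z - M%:Z)%R)) ?IH; last first.
  by move=> i _; congr Snorm; lia.
rewrite -SnormN (_ : (- _)%R = M.+1%:Z%R); last by lia.
by rewrite (_ : (_ - _)%R = M.+1%:Z%R); lia.
Qed.

Lemma Sseq_thr7 n : 0 < n -> Sseq n = thr (n + 7) + thr (n + 1) + 1.
Proof. by case: n => // n _; rewrite Sseq_thr !addSnnS. Qed.

(** Below S_n the greedy step reflects: t_(n-1) + i leaves a remainder of absolute value t_(n-7) + 1
    - i, so a tail of the sum up to t_(n-7) appears. *)
Lemma cumSnorm_low n k : 0 < n -> k <= thr (n + 1) ->
  cumSnorm (thr (n + 7) + k) + cumSnorm (thr (n + 1) - k) =
  cumSnorm (thr (n + 7)) + k + cumSnorm (thr (n + 1)).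
Proof.
move=> n_gt0; elim: k => [|k IH] le_k; first by rewrite subn0 !addn0.
have {IH} := IH (ltnW le_k).
rewrite (_ : thr (n + 1) - k = (thr (n + 1) - k.+1).+1); last by lia.
have ES := Sseq_thr7 n_gt0; have Et := thrE n.
rewrite (addnS (thr _)) !cumSnormS (@Snorm_leading n (_ + k).+1); [|lia..].
rewrite -(SnormN (_ - _)) (_ : (- _)%R = (thr (n + 1) - k.+1).+1%:Z%R); last by lia.
lia.
Qed.

(** The reflected part ends at S_n - 1; then S_n has weight 1, and S_n + i leaves the remainder
    i. *)
Lemma cumSnorm_high n j : 0 < n -> j <= thr n ->
  cumSnorm (Sseq n + j) =
  cumSnorm (thr (n + 7)) + thr (n + 1) + cumSnorm (thr (n + 1)) + 1 + j + cumSnorm j.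
Proof.
move=> n_gt0; have ES := Sseq_thr7 n_gt0; have Et := thrE n.
elim: j => [|j IH] le_j.
  have := cumSnorm_low n_gt0 (leqnn _); rewrite subnn cumSnorm0 => E.
  rewrite addn0 {1}ES addn1 cumSnormS (@Snorm_leading n); [|lia..].
  by rewrite (_ : (_ - _)%R = 0%R) ?Snorm0 ?cumSnorm0; lia.
have {IH} := IH (ltnW le_j).
rewrite (addnS (Sseq n)) !cumSnormS (@Snorm_leading n (_ + j).+1); [|lia..].
by rewrite (_ : (_ - _)%R = j.+1%:Z%R); lia.
Qed.

Lemma thr_rec n : 0 < n -> thr (n + 8) = thr (n + 7) + thr (n + 1) + thr n + 1.
Proof. by move=> /Sseq_thr7; rewrite thrE; lia. Qed.

Lemma cumSnorm_thr n : 0 < n -> cumSnorm (thr (n + 8)) + thr (n + 7) =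
  cumSnorm (thr (n + 7)) + cumSnorm (thr (n + 1)) + cumSnorm (thr n) + thr (n + 8).
Proof.
move=> n_gt0; have := thr_rec n_gt0.
by rewrite {2}thrE (cumSnorm_high n_gt0 (leqnn _)); lia.
Qed.

End CumulativeWeight.

(** * Growth of the thresholds and of the cumulative weights *)

Section Growth.
Local Open Scope ring_scope.

Lemma beta_bounds (R : realFieldType) (beta : R) :
  1 < beta -> beta ^+ 3 = beta + 1 -> 33 / 25 < beta < 133 / 100.
Proof. by move=> gt1 eq; apply/andP; split; nra. Qed.

(** Subtracting beta times the previous term removes the factor X - beta from X^3 - X - 1 and leaves
    X^2 + beta X + beta^2 - 1. *)
Lemma Sseq_almost_geometric (R : realFieldType) (beta : R) :
  1 < beta -> beta ^+ 3 = beta + 1 ->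
  exists2 C : R, 0 <= C &
    forall n, `|(Sseq n.+1)%:R - beta * (Sseq n)%:R| <= C.
Proof.
move=> gt1 eq; have /andP[beta_gt beta_lt] := beta_bounds gt1 eq.
pose d n : R := (Sseq n.+1)%:R - beta * (Sseq n)%:R.
have d_rec n : d n.+3 = - beta * d n.+2 - (beta ^+ 2 - 1) * d n.+1.
  rewrite /d (SseqE n) natrD.
  by ring: eq.
(* q is positive definite and is multiplied by beta ^+ 2 - 1 = 1 / beta at
   each step: the conjugates of beta have modulus less than 1. *)
pose q (x y : R) := x ^+ 2 + beta * x * y + (beta ^+ 2 - 1) * y ^+ 2.
have q_ge (x y : R) : y ^+ 2 / 4 <= q x y.
  have := sqr_ge0 (x + beta / 2 * y); have := sqr_ge0 y; rewrite /q; nra.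
have q_le n : q (d n.+2) (d n.+1) <= q (d 2) (d 1).
  elim: n => // n; apply: le_trans; rewrite d_rec.
  have -> x y : q (- beta * x - (beta ^+ 2 - 1) * y) x = (beta ^+ 2 - 1) * q x y.
    by rewrite /q; ring.
  have := q_ge (d n.+2) (d n.+1); have := sqr_ge0 (d n.+1); nra.
have le_abs (x c : R) : x ^+ 2 / 4 <= c -> `|x| <= 4 * c + 1.
  by rewrite ler_norml => le_c; apply/andP; split; nra.
have q2_ge0 : 0 <= q (d 2) (d 1).
  by have := q_ge (d 2) (d 1); have := sqr_ge0 (d 1); lra.
have d0_ge0 : 0 <= `|d 0| by [].
(* [d 0] is bounded apart: the recurrence of S fails at S_3, so [d_rec] starts from [d 1]. *)
exists (`|d 0| + (4 * q (d 2) (d 1) + 1)) => [|[|n]]; first by lra.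
  by rewrite -/(d 0); lra.
rewrite -/(d n.+1); have := le_abs _ _ (le_trans (q_ge _ _) (q_le n)); lra.
Qed.


(** [thr n] sums about n / 8 terms of S, each shifted with bounded error, hence an error linear in
    n. *)
Lemma thr_shift (R : realFieldType) (beta : R) :
  1 < beta -> beta ^+ 3 = beta + 1 -> forall j, exists2 C : R, 0 <= C &
    forall n, `|(thr (n + j))%:R - beta ^+ j * (thr n)%:R| <= C * n.+1%:R.
Proof.
move=> gt1 eq; have /andP[beta_gt beta_lt] := beta_bounds gt1 eq.
have [C C_ge0 C_le] := Sseq_almost_geometric gt1 eq.
have one n : `| (thr n.+1)%:R - beta * (thr n)%:R| <= (C + 2) * n.+1%:R.
  have small x n' : `|x| <= 2 -> `|x| <= (C + 2) * n'.+1%:R :> R.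
    by have : 1 <= n'.+1%:R :> R by [rewrite ler1n]; nra.
  elim/nat_ind8: n => [||||||||n IH];
    try by apply: small; rewrite ler_norml /=; apply/andP; split; lra.
  rewrite -addSn !thrE !natrD.
  have -> : (Sseq n.+1)%:R + (thr n.+1)%:R - beta * ((Sseq n)%:R + (thr n)%:R) =
    ((Sseq n.+1)%:R - beta * (Sseq n)%:R) + ((thr n.+1)%:R - beta * (thr n)%:R).
    by ring.
  apply: le_trans (ler_normD _ _) _; apply: le_trans (lerD (C_le n) IH) _.
  by have : 0 <= n.+1%:R :> R by []; nra.
elim=> [|j [D D_ge0 D_le]].
  by exists 0 => // n; rewrite addn0 expr0 mul1r subrr normr0 mul0r.
exists ((C + 2) * j.+1%:R + beta * D) => [|n].
  by rewrite addr_ge0 ?mulr_ge0 ?addr_ge0 //; lra.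
have -> : (thr (n + j.+1))%:R - beta ^+ j.+1 * (thr n)%:R =
    ((thr (n + j).+1)%:R - beta * (thr (n + j))%:R) +
    beta * ((thr (n + j))%:R - beta ^+ j * (thr n)%:R) :> R.
  by rewrite addnS exprS; ring.
apply: le_trans (ler_normD _ _) _; rewrite mulrDl; apply: lerD.
  apply: le_trans (one _) _; rewrite -mulrA -natrM.
  by apply: ler_wpM2l; [lra | rewrite ler_nat; nia].
rewrite normrM ger0_norm -?mulrA; last by lra.
by apply: ler_wpM2l; [lra | exact: D_le].
Qed.

Definition rate (R : realFieldType) (beta : R) : R := (7 + 2 * beta ^+ 2)^-1.

Lemma rate_bounds (R : realFieldType) (beta : R) :
  1 < beta -> beta ^+ 3 = beta + 1 -> 0 < rate beta <= 1.
Proof.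
move=> gt1 eq; rewrite /rate; have : 1 <= 7 + 2 * beta ^+ 2 by nra.
by move=> ge1; rewrite invr_gt0 invf_le1; lra.
Qed.

Definition defect (R : realFieldType) (beta : R) (k : nat) : R :=
  (cumSnorm (thr k))%:R - rate beta * k%:R * (thr k)%:R.

(** The half turns [thr_rec] into a homogeneous recurrence and keeps the value positive. *)
Definition tau (R : realFieldType) (k : nat) : R := (thr k)%:R + 2^-1.

Lemma tau_rec (R : realFieldType) n : (0 < n)%N ->
  tau R (n + 8) = tau R (n + 7) + tau R (n + 1) + tau R n.
Proof. by move=> /thr_rec E; rewrite /tau E !natrD; field. Qed.

Lemma tau_mono (R : realFieldType) m n : (m <= n)%N -> tau R m <= tau R n.
Proof. by move=> /thr_mono; rewrite /tau lerD2r ler_nat. Qed.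

(* The choice of rate cancels the term proportional to thr n. *)
Lemma defect_rec (R : realFieldType) (beta : R) :
  1 < beta -> beta ^+ 3 = beta + 1 -> exists2 C : R, 0 <= C &
  forall n, (0 < n)%N ->
    `|defect beta (n + 8) - (defect beta (n + 7) + defect beta (n + 1) + defect beta n)|
      <= C * n.+1%:R.
Proof.
move=> gt1 eq; have [C8 C8_ge0 C8_le] := thr_shift gt1 eq 8.
have [C7 C7_ge0 C7_le] := thr_shift gt1 eq 7.
have [C1 C1_ge0 C1_le] := thr_shift gt1 eq 1.
have /andP[c_gt0 c_le1] := rate_bounds gt1 eq.
exists (8 * C7 + C1 + 8 * C8 + C8 + 1) => [|n n_gt0]; first by lra.
have rate_root : rate beta * (7 * beta ^+ 7 + beta - 8 * beta ^+ 8)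
    + beta ^+ 8 - beta ^+ 7 = 0.
  have nz : 7 + 2 * beta ^+ 2 != 0 by rewrite -invr_eq0 gt_eqF.
  rewrite /rate; field: eq => //.
have {}C8_le := C8_le n; have {}C7_le := C7_le n; have {}C1_le := C1_le n.
have /(congr1 (fun k => k%:R : R)) := cumSnorm_thr n_gt0.
have /(congr1 (fun k => k%:R : R)) := thr_rec n_gt0.
rewrite /defect !natrD => E1 E2; move: C8_le C7_le C1_le.
set T8 : R := (thr (n + 8))%:R; set T7 : R := (thr (n + 7))%:R.
set T1 : R := (thr (n + 1))%:R; set T : R := (thr n)%:R.
rewrite -/T8 -/T7 -/T1 -/T in E1 E2.
set e8 : R := T8 - _; set e7 : R := T7 - _; set e1 : R := T1 - _ => C8_le C7_le C1_le.
rewrite (_ : _ - _ = e8 - e7 + rate beta * (7 * e7 + e1 - 8 * e8 - n%:R)); last first.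
  rewrite /e8 /e7 /e1 expr1.
  have -> : (cumSnorm (thr (n + 8)))%:R = (cumSnorm (thr (n + 7)))%:R +
    (cumSnorm (thr (n + 1)))%:R + (cumSnorm (thr n))%:R + T8 - T7 by lra.
  have ET : rate beta * n%:R * (T8 - T7 - T1 - T - 1) = 0 by rewrite E1; ring.
  have := congr1 (fun x => T * x) rate_root; rewrite mulr0 => rT; lra.
have n1 : n.+1%:R = n%:R + 1 :> R by rewrite -natr1.
have n_ge0 : 0 <= n%:R :> R by [].
move: C8_le C7_le C1_le; rewrite n1 !ler_norml.
move=> /andP[? ?] /andP[? ?] /andP[? ?].
have le_x : `|7 * e7 + e1 - 8 * e8 - n%:R| <= (7 * C7 + C1 + 8 * C8 + 1) * (n%:R + 1).
  by rewrite ler_norml; apply/andP; split; lra.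
have x_ge0 := normr_ge0 (7 * e7 + e1 - 8 * e8 - n%:R).
have : `|rate beta * (7 * e7 + e1 - 8 * e8 - n%:R)|
    <= (7 * C7 + C1 + 8 * C8 + 1) * (n%:R + 1).
  by rewrite normrM gtr0_norm //; nra.
rewrite ler_norml => /andP[? ?].
by apply/andP; split; lra.
Qed.

Lemma cumSnorm_le1 M : (M <= 1)%N -> (cumSnorm M <= 1)%N.
Proof. by case: M => [|[|]] // _; rewrite ?cumSnorm0 // cumSnormS cumSnorm0 SnormE. Qed.

Lemma small_index (R : realFieldType) (beta : R) k M :
  1 < beta -> beta ^+ 3 = beta + 1 -> (k <= 8)%N -> (M <= 1)%N ->
  `|(cumSnorm M)%:R - rate beta * k%:R * M%:R| <= 9.
Proof.
move=> gt1 eq k8 M1; have /andP[c_gt0 c_le1] := rate_bounds gt1 eq.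
have : (cumSnorm M)%:R <= 1 :> R by rewrite lern1; exact: cumSnorm_le1.
have : M%:R <= 1 :> R by rewrite lern1.
have : k%:R <= 8 :> R by rewrite ler_nat.
have : 0 <= (cumSnorm M)%:R :> R by []; have : 0 <= M%:R :> R by [].
have : 0 <= k%:R :> R by [].
move: (cumSnorm M)%:R M%:R k%:R (rate beta) c_gt0 c_le1.
move=> u x y c c0 c1 y0 x0 u0 y8 x1 u1.
have cy : 0 <= c * y <= 8 by apply/andP; split; nra.
by rewrite ler_norml; apply/andP; split; nra.
Qed.

Lemma thr_le8 k : (k <= 8)%N -> (thr k <= 1)%N.
Proof. by move=> /thr_mono. Qed.

Lemma defect_bound (R : realFieldType) (beta : R) :
  1 < beta -> beta ^+ 3 = beta + 1 -> exists2 K : R, 0 <= K &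
  forall k, (0 < k)%N -> `|defect beta k| <= K * tau R k.
Proof.
move=> gt1 eq; have [C C_ge0 C_le] := defect_rec gt1 eq.
(* For k <= 8 we have [tau] >= 1/2 and k + 1 <= 9, so this constant leaves 9, the bound of
   [small_index]. *)
exists (18 * C + 18) => [|k k_gt0]; first by lra.
(* The subtracted linear term absorbs the error of [defect_rec]: (n+8) + (n+2) + (n+1) >= (n+9) +
   (n+1). *)
suff : `|defect beta k| <= (18 * C + 18) * tau R k - C * k.+1%:R.
  by have : 0 <= k.+1%:R :> R by []; nra.
have [m] := ubnP k; elim: m k k_gt0 => // m IH k k_gt0 lt_km.
case: (leqP k 8) => [k8|].
  apply: le_trans (small_index gt1 eq k8 (thr_le8 k8)) _.
  have : 2^-1 <= tau R k by rewrite /tau lerDr.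
  by have : k.+1%:R <= 9 :> R by [rewrite ler_nat]; nra.
move=> lt8k; pose n := (k - 8)%N; have -> : k = (n + 8)%N by rewrite /n; lia.
have n_gt0 : (0 < n)%N by rewrite /n; lia.
have := C_le n n_gt0; have := tau_rec R n_gt0.
have : `|defect beta (n + 7)| <= (18 * C + 18) * tau R (n + 7) - C * (n + 7).+1%:R.
  by apply: IH; rewrite /n; lia.
have : `|defect beta (n + 1)| <= (18 * C + 18) * tau R (n + 1) - C * (n + 1).+1%:R.
  by apply: IH; rewrite /n; lia.
have : `|defect beta n| <= (18 * C + 18) * tau R n - C * n.+1%:R.
  by apply: IH; rewrite /n; lia.
have : 0 <= n%:R :> R by [].
rewrite -!natr1 !natrD !ler_norml.
move=> ? /andP[? ?] /andP[? ?] /andP[? ?] -> /andP[? ?].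
by apply/andP; split; nra.
Qed.

(** The recurrence preserves the ratio bound; 3 is attained between [thr 5] = 0 and [thr 6] = 1. *)
Lemma tau_ratio (R : realFieldType) k : tau R k.+1 <= 3 * tau R k.
Proof.
have [m] := ubnP k; elim: m k => // m IH k lt_km.
case: (leqP k 8) => [|lt8k].
  by move: k {lt_km} => [|[|[|[|[|[|[|[|[|]]]]]]]]] //= _; rewrite /tau /=; lra.
pose n := (k - 8)%N; have -> : k = (n + 8)%N by rewrite /n; lia.
have n_gt0 : (0 < n)%N by rewrite /n; lia.
rewrite -addSn !tau_rec // !addSn.
have IH7 : tau R (n + 7).+1 <= 3 * tau R (n + 7) by apply: IH; rewrite /n; lia.
have IH1 : tau R (n + 1).+1 <= 3 * tau R (n + 1) by apply: IH; rewrite /n; lia.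
have IH0 : tau R n.+1 <= 3 * tau R n by apply: IH; rewrite /n; lia.
lra.
Qed.

Lemma tau_shift (R : realFieldType) n j : tau R (n + j) <= 3 ^+ j * tau R n.
Proof.
elim: j => [|j IH]; first by rewrite addn0 expr0 mul1r.
by rewrite addnS exprS -mulrA (le_trans (tau_ratio _ _)) // ler_pM2l.
Qed.

(** This isolates the error at the remainder j, to which induction applies; the factor 7 is the gap
    between the indices n + 8 and n + 1. *)
Lemma cumSnorm_low_defect (R : realFieldType) (beta : R) n i :
  (0 < n)%N -> (i <= thr (n + 1))%N ->
  let j := (thr (n + 1) - i)%N in
  (cumSnorm (thr (n + 7) + i))%:R - rate beta * (n + 8)%:R * (thr (n + 7) + i)%:R =
  defect beta (n + 7) + defect beta (n + 1)
    - ((cumSnorm j)%:R - rate beta * (n + 1)%:R * j%:R)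
    + i%:R - rate beta * ((thr (n + 7))%:R + 7 * i%:R).
Proof.
move=> n_gt0 le_i; have := congr1 (fun k => k%:R : R) (cumSnorm_low n_gt0 le_i).
rewrite /defect /= !natrD natrB // => /(canRL (addrK _)) ->; ring.
Qed.

Lemma cumSnorm_high_defect (R : realFieldType) (beta : R) n j :
  (0 < n)%N -> (j <= thr n)%N ->
  (cumSnorm (Sseq n + j))%:R - rate beta * (n + 8)%:R * (Sseq n + j)%:R =
  defect beta (n + 7) + defect beta (n + 1) + ((cumSnorm j)%:R - rate beta * n%:R * j%:R)
    + (thr (n + 1))%:R + 1 + j%:R
    - rate beta * ((thr (n + 7))%:R + 7 * (thr (n + 1))%:R + 8 * j%:R + n%:R + 8).
Proof.
move=> n_gt0 le_j; rewrite (cumSnorm_high n_gt0 le_j) (Sseq_thr7 n_gt0) /defect !natrD.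
ring.
Qed.

(** Each greedy case inherits a single error with constant K, at a smaller index. The threshold
    errors with constant K5 and the lower-order terms fit into the remaining summands of K [tau] (n
    + 8). *)
Lemma cumSnorm_bound_step (R : realFieldType) (beta K5 K : R) n M :
  1 < beta -> beta ^+ 3 = beta + 1 -> 0 <= K5 -> K = 2 * K5 + 769 ->
  (forall k, (0 < k)%N -> `|defect beta k| <= K5 * tau R k) -> (0 < n)%N ->
  (forall k M, (k < n + 8)%N -> (M <= thr k)%N ->
    `|(cumSnorm M)%:R - rate beta * k%:R * M%:R| <= K * tau R k) ->
  (M <= thr (n + 8))%N ->
  `|(cumSnorm M)%:R - rate beta * (n + 8)%:R * M%:R| <= K * tau R (n + 8).
Proof.
move=> gt1 eq K5_ge0 EK K5_le n_gt0 IH le_M.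
have /andP[c_gt0 c_le1] := rate_bounds gt1 eq.
have c_mul (x : R) : 0 <= x -> 0 <= rate beta * x <= x.
  by move=> x_ge0; rewrite ler_piMl // andbT mulr_ge0 // ltW.
have rem7 := K5_le (n + 7)%N (ltn_addr _ n_gt0).
have rem1 := K5_le (n + 1)%N (ltn_addr _ n_gt0).
have t17 : tau R (n + 1) <= tau R (n + 7) by apply: tau_mono; rewrite leq_add2l.
have t01 : tau R n <= tau R (n + 1) by apply: tau_mono; apply: leq_addr.
(* 729 = 3^6. For M <= t_(n-1), the index change costs at most [tau] (n + 7), which K [tau] (n + 1)
   must cover; hence a K above 729. *)
have t71 : tau R (n + 7) <= 729 * tau R (n + 1).
  by have := tau_shift R (n + 1) 6; rewrite -addnA; lra.
have t0 : 2^-1 <= tau R n by rewrite /tau lerDr.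
have T7 : (thr (n + 7))%:R = tau R (n + 7) - 2^-1 by rewrite /tau addrK.
have T1 : (thr (n + 1))%:R = tau R (n + 1) - 2^-1 by rewrite /tau addrK.
have T0 : (thr n)%:R = tau R n - 2^-1 by rewrite /tau addrK.
have n_le : n%:R <= tau R (n + 7) + tau R (n + 1) + tau R n.
  rewrite -tau_rec // /tau (le_trans (_ : _ <= (thr (n + 8))%:R)) ?lerDl //.
  by rewrite ler_nat leq_thr.
have K5t7 : 0 <= K5 * (tau R (n + 7) - tau R (n + 1)) by rewrite mulr_ge0 ?subr_ge0.
have K5t1 : 0 <= K5 * (tau R (n + 1) - tau R n) by rewrite mulr_ge0 ?subr_ge0.
have K5t0 : 0 <= K5 * tau R n by rewrite mulr_ge0 // (le_trans _ t0).
have n_ge0 : 0 <= n%:R :> R by [].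
case: (leqP M (thr (n + 7))) => [le_M7|lt7M].
  have := IH (n + 7)%N M (_ : (n + 7 < n + 8)%N) le_M7; rewrite ltn_add2l => /(_ isT).
  have M7 : M%:R <= (thr (n + 7))%:R :> R by rewrite ler_nat.
  have M_ge0 : 0 <= M%:R :> R by [].
  have /andP[cM0 cM1] := c_mul M%:R M_ge0.
  rewrite tau_rec // EK (natrD _ n 7) (natrD _ n 8) T7 in M7 *.
  clear -K5t7 K5t1 K5t0 t71 t01 t0 cM0 cM1 M7.
  by rewrite !ler_norml => /andP[l1 l2]; apply/andP; split; lra.
case: (leqP (Sseq n) M) => [leSM|ltMS].
  have le_j : (M - Sseq n <= thr n)%N by rewrite leq_subLR -thrE.
  rewrite -(subnKC leSM) (cumSnorm_high_defect _ n_gt0 le_j).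
  have := IH n _ (_ : (n < n + 8)%N) le_j.
  rewrite -[X in (X < _)%N]addn0 ltn_add2l => /(_ isT).
  have : (M - Sseq n)%:R <= (thr n)%:R :> R by rewrite ler_nat.
  have : 0 <= (M - Sseq n)%:R :> R by [].
  move: (M - Sseq n)%N {le_j} => j j_ge0 j_le.
  have T1_ge0 : 0 <= (thr (n + 1))%:R :> R by [].
  have T7_ge0 : 0 <= (thr (n + 7))%:R :> R by [].
  have /c_mul/andP[] : 0 <= (thr (n + 7))%:R + 7 * (thr (n + 1))%:R
      + 8 * j%:R + n%:R + 8 :> R by lra.
  rewrite tau_rec // EK T7 T1; move: j_le rem7 rem1; rewrite T0.
  move: (_ - _ * j%:R) (rate beta * _) => g cX; rewrite !ler_norml.
  clear -K5t7 K5t1 K5t0 t01 t0 t17 n_le n_ge0 j_ge0.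
  by move=> ? /andP[? ?] /andP[? ?] ? ? /andP[? ?]; apply/andP; split; lra.
have le_i : (M - thr (n + 7) <= thr (n + 1))%N.
  by move: ltMS; rewrite leq_subLR Sseq_thr7 // addn1 ltnS.
rewrite -(subnKC (ltnW lt7M)) (cumSnorm_low_defect _ n_gt0 le_i).
have := IH (n + 1)%N _ (_ : (n + 1 < n + 8)%N) (leq_subr (M - thr (n + 7)) _).
rewrite ltn_add2l => /(_ isT).
have : (M - thr (n + 7))%:R <= (thr (n + 1))%:R :> R by rewrite ler_nat.
have : 0 <= (M - thr (n + 7))%:R :> R by [].
move: (M - thr (n + 7))%N {le_i} => i i_ge0 i_le.
have T7_ge0 : 0 <= (thr (n + 7))%:R :> R by [].
have /c_mul/andP[] : 0 <= (thr (n + 7))%:R + 7 * i%:R :> R by lra.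
rewrite tau_rec // EK T7; move: i_le rem7 rem1; rewrite T1.
move: (_ - _ * (thr (n + 1) - i)%:R) (rate beta * _) => g cX; rewrite !ler_norml.
clear -K5t7 K5t1 K5t0 t01 t0 t17 i_ge0.
by move=> ? /andP[? ?] /andP[? ?] ? ? /andP[? ?]; apply/andP; split; lra.
Qed.

Lemma cumSnorm_bound (R : realFieldType) (beta : R) :
  1 < beta -> beta ^+ 3 = beta + 1 -> exists2 K : R, 0 <= K &
  forall k M, (M <= thr k)%N ->
    `|(cumSnorm M)%:R - rate beta * k%:R * M%:R| <= K * tau R k.
Proof.
move=> gt1 eq; have [K5 K5_ge0 K5_le] := defect_bound gt1 eq.
exists (2 * K5 + 769) => [|k]; first by lra.
have [m] := ubnP k; elim: m k => // m IH k; rewrite ltnS => le_km M le_M.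
case: (leqP k 8) => [k8|lt8k].
  apply: le_trans (small_index gt1 eq k8 (leq_trans le_M (thr_le8 k8))) _.
  have t_ge : 2^-1 <= tau R k by rewrite /tau lerDr.
  by have : 0 <= K5 * tau R k by [rewrite mulr_ge0 // (le_trans _ t_ge)]; lra.
have Ek := subnK (ltnW lt8k); rewrite -Ek in le_km le_M *.
apply: (cumSnorm_bound_step gt1 eq K5_ge0 erefl K5_le) => //; first by rewrite subn_gt0.
by move=> k' M' lt_k'; apply: IH; apply: leq_trans lt_k' le_km.
Qed.

Lemma Sseq_geometric (R : realFieldType) (beta : R) n :
  1 < beta -> beta ^+ 3 = beta + 1 ->
  beta ^+ n <= (Sseq n)%:R <= 2 * beta ^+ n.
Proof.
move=> gt1 eq; have /andP[beta_gt beta_lt] := beta_bounds gt1 eq.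
have [m] := ubnP n; elim: m n => // m IH n lt_nm.
case: n lt_nm => [|[|[|[|n]]]] lt_nm.
- by rewrite expr0 /=; apply/andP; split; lra.
- by rewrite expr1 /=; apply/andP; split; lra.
- by rewrite /=; apply/andP; split; nra.
- by rewrite eq /=; apply/andP; split; lra.
have /andP[] := IH n.+1 (ltnW (ltnW lt_nm)).
have /andP[] := IH n.+2 (ltnW lt_nm).
have -> : beta ^+ n.+4 = beta ^+ n.+2 + beta ^+ n.+1.
  by rewrite -[n.+4]/(3 + n.+1)%N exprD eq (exprS _ n.+1); ring.
by rewrite SseqE natrD => *; apply/andP; split; lra.
Qed.

End Growth.

(** * From threshold indices to logarithms *)

Local Open Scope ring_scope.

Lemma thr_bracket (M : nat) : (2 < M)%N ->
  exists2 n, (0 < n)%N & (thr (n + 8) < M <= thr (n + 9))%N.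
Proof.
move=> gt2; have ex : exists k, (M <= thr k)%N by exists (M + 8)%N; exact: leq_thr.
(* [thr 9] = 2 < M, so n = k - 9 is positive. *)
case: (ex_minnP ex) => k leM k_min; have lt9k : (9 < k)%N.
  rewrite ltnNge; apply/negP => /thr_mono le9.
  by have := leq_trans gt2 (leq_trans leM le9).
exists (k - 9)%N; first by rewrite subn_gt0.
rewrite subnK ?leM ?andbT; last exact: ltnW.
rewrite ltnNge; apply/negP => /k_min; rewrite -[k in (k <= _)%N](subnK (ltnW lt9k)).
by rewrite leq_add2l.
Qed.

Lemma log_bracket (R : realType) (beta : R) (n M : nat) :
  1 < beta -> beta ^+ 3 = beta + 1 -> (0 < n)%N ->
  (thr (n + 8) < M <= thr (n + 9))%N ->
  n%:R <= ln M%:R / ln beta <= n%:R + 5.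
Proof.
move=> gt1 eq n_gt0 /andP[ltM leM].
have /andP[lo _] := Sseq_geometric n gt1 eq.
have /andP[_ up] := Sseq_geometric n.+2 gt1 eq.
have beta_gt0 : 0 < beta by lra.
have ln_gt0 : 0 < ln beta by rewrite ln_gt0.
have geM : beta ^+ n <= M%:R.
  apply: le_trans lo _; rewrite ler_nat (leq_trans _ (ltnW ltM)) // thrE.
  exact: leq_addr.
have leM' : M%:R <= beta ^+ (n + 5).
  apply: (@le_trans _ _ (Sseq n.+2)%:R).
    rewrite ler_nat (leq_trans leM) // Sseq_thr -(addSnnS n) -addnA.
    exact: leq_addr.
  (* The factor 2 is absorbed by beta^3 = beta + 1 >= 2. *)
  apply: le_trans up _; rewrite (_ : n + 5 = 3 + n.+2)%N; last by rewrite addnC.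
  by rewrite exprD eq ler_pM2r ?exprn_gt0 //; lra.
have M_gt0 : 0 < M%:R :> R by apply: lt_le_trans geM; rewrite exprn_gt0.
rewrite ler_pdivlMr // ler_pdivrMr //; apply/andP; split.
  rewrite mulr_natl -lnXn // ler_ln ?posrE ?exprn_gt0 //.
by rewrite -(natrD _ n 5) mulr_natl -lnXn // ler_ln ?posrE ?exprn_gt0.
Qed.

Theorem mainTheorem17 (R : realType) (beta : R)
    (beta_gt1 : 1 < beta) (beta_eq : beta ^+ 3 = beta + 1) :
  (fun M : nat =>
     (2 * M%:R + 1)^-1 * (\sum_(0 <= i < (2 * M).+1) Snorm (i%:Z - M%:Z))%:R)
  = (fun M : nat => (7 + 2 * beta ^+ 2)^-1 * (ln M%:R / ln beta))
    +O_\oo (fun=> 1 : R).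
Proof.
have [K K_ge0 K_le] := cumSnorm_bound beta_gt1 beta_eq.
have /andP[c_gt0 c_le1] := rate_bounds beta_gt1 beta_eq.
(* Multiplied by 2M + 1, the error consists of 2 K [tau] (n + 9) <= 6 K M, at most 18 M for
   replacing n + 9 by the logarithm L, and [rate beta] L <= M + 5. *)
apply/eqaddOP/bigO_exP; exists (3 * K + 20); first by rewrite /=; lra.
exists 3%N => // M /= gt2.
rewrite !fctE normr1 mulr1 sum_Snorm_sym -/(rate beta) natrM.
have [n n_gt0 br] := thr_bracket gt2.
have /andP[le_L L_le] := log_bracket beta_gt1 beta_eq n_gt0 br.
have /andP[ltM leM] := br.
have := K_le _ _ leM; rewrite natrD.
have tau_le : tau R (n + 9) <= 3 * M%:R.
  rewrite addnS; apply: le_trans (tau_ratio _ _) _; rewrite ler_pM2l // /tau.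
  have : (thr (n + 8))%:R + 1 <= M%:R :> R by rewrite natr1 ler_nat.
  lra.
have n_le : n%:R <= M%:R :> R.
  by rewrite ler_nat (leq_trans (leq_thr n)) // ltnW.
have K_tau : K * tau R (n + 9) <= K * (3 * M%:R) by rewrite ler_wpM2l.
have M_ge0 : 0 <= M%:R :> R by []; have n_ge0 : 0 <= n%:R :> R by [].
move: (ln _ / ln _) le_L L_le => L le_L L_le.
have cL : 0 <= rate beta * L <= L.
  by rewrite ler_piMl ?mulr_ge0 ?andbT //; lra.
have cML : 0 <= rate beta * (M%:R * (n%:R + 9 - L)) <= M%:R * (n%:R + 9 - L).
  have : 0 <= M%:R * (n%:R + 9 - L) by rewrite mulr_ge0 //; lra.
  by move=> x_ge0; rewrite ler_piMl // andbT mulr_ge0 // ltW.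
have ML : M%:R * (n%:R + 9 - L) <= M%:R * 9 by rewrite ler_wpM2l //; lra.
have pos : 0 < 2 * M%:R + 1 :> R by lra.
have -> x : (2 * M%:R + 1)^-1 * x - rate beta * L =
    (2 * M%:R + 1)^-1 * (x - rate beta * L * (2 * M%:R + 1)).
  by field; lra.
rewrite normrM gtr0_norm ?invr_gt0 // ler_pdivrMl // => le_cum.
case/andP: cL cML => ? ? /andP[? ?].
move: le_cum; rewrite !ler_norml => /andP[? ?].
by apply/andP; split; lra.
Qed.
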